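(* For all rational numbers $f,g,d$, define $$\begin{aligned} x_1&=(6f^2+12fg+6g^2+d)(-30f^2+4fg+2g^2+d),\\ x_2&=(-6f^2+4fg+10g^2+d)(30f^2-4fg-2g^2+d),\\ x_3&=(18f^2+20fg+2g^2+d)(-18f^2+12fg-2g^2+d),\\ x_4&=(6f^2-4fg-10g^2+d)(18f^2-12fg+2g^2+d),\\ x_5&=(-6f^2+20fg-6g^2+d)(-18f^2-20fg-2g^2+d),\\ x_6&=(6f^2-20fg+6g^2+d)(-6f^2-12fg-6g^2+d),\\ y_1&=(-18f^2+12fg-2g^2+d)(-6f^2+4fg+10g^2+d),\\ y_2&=(6f^2-20fg+6g^2+d)(18f^2+20fg+2g^2+d),\\ y_3&=(-6f^2+20fg-6g^2+d)(6f^2+12fg+6g^2+d),\\ y_4&=(30f^2-4fg-2g^2+d)(-6f^2-12fg-6g^2+d),\\ y_5&=(-30f^2+4fg+2g^2+d)(6f^2-4fg-10g^2+d),\\ y_6&=(18f^2-12fg+2g^2+d)(-18f^2-20fg-2g^2+d). \end{aligned}$$ Then $$\sum_{i=1}^6x_i^r=\sum_{i=1}^6y_i^r\quad\text{for } r=1,2,3,4,\qquad\text{and}\qquad \prod_{i=1}^6x_i=\prod_{i=1}^6y_i.$$ Moreover, as a parametric solution this is nontrivial: in $\mathbb{Q}[f,g,d]$ the multisets $\{x_1,\dots,x_6\}$ and $\{y_1,\dots,y_6\}$ are distinct. *)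

(* Defs.v *)
From HB Require Import structures.
From mathcomp Require Import all_boot all_order all_algebra.
From mathcomp Require Import mpoly.

Set Implicit Arguments.
Unset Strict Implicit.
Unset Printing Implicit Defensive.

Import GRing.Theory.
Local Open Scope ring_scope.

(* The two sextuples are defined over an arbitrary commutative ring, so that
   the same formulas give both the rational values at rational f, g, d and the
   elements of Q[f, g, d] obtained when f, g, d are indeterminates. Components
   are numbered from 0: x_i and y_i (1 <= i <= 6) have index i - 1. *)
Definition xs (R : comNzRingType) (f g d : R) : 6.-tuple R :=
  [tuple
    (6 * f ^+ 2 + 12 * f * g + 6 * g ^+ 2 + d)
      * (- 30 * f ^+ 2 + 4 * f * g + 2 * g ^+ 2 + d);
    (- 6 * f ^+ 2 + 4 * f * g + 10 * g ^+ 2 + d)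
      * (30 * f ^+ 2 - 4 * f * g - 2 * g ^+ 2 + d);
    (18 * f ^+ 2 + 20 * f * g + 2 * g ^+ 2 + d)
      * (- 18 * f ^+ 2 + 12 * f * g - 2 * g ^+ 2 + d);
    (6 * f ^+ 2 - 4 * f * g - 10 * g ^+ 2 + d)
      * (18 * f ^+ 2 - 12 * f * g + 2 * g ^+ 2 + d);
    (- 6 * f ^+ 2 + 20 * f * g - 6 * g ^+ 2 + d)
      * (- 18 * f ^+ 2 - 20 * f * g - 2 * g ^+ 2 + d);
    (6 * f ^+ 2 - 20 * f * g + 6 * g ^+ 2 + d)
      * (- 6 * f ^+ 2 - 12 * f * g - 6 * g ^+ 2 + d)].

Definition ys (R : comNzRingType) (f g d : R) : 6.-tuple R :=
  [tuple
    (- 18 * f ^+ 2 + 12 * f * g - 2 * g ^+ 2 + d)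
      * (- 6 * f ^+ 2 + 4 * f * g + 10 * g ^+ 2 + d);
    (6 * f ^+ 2 - 20 * f * g + 6 * g ^+ 2 + d)
      * (18 * f ^+ 2 + 20 * f * g + 2 * g ^+ 2 + d);
    (- 6 * f ^+ 2 + 20 * f * g - 6 * g ^+ 2 + d)
      * (6 * f ^+ 2 + 12 * f * g + 6 * g ^+ 2 + d);
    (30 * f ^+ 2 - 4 * f * g - 2 * g ^+ 2 + d)
      * (- 6 * f ^+ 2 - 12 * f * g - 6 * g ^+ 2 + d);
    (- 30 * f ^+ 2 + 4 * f * g + 2 * g ^+ 2 + d)
      * (6 * f ^+ 2 - 4 * f * g - 10 * g ^+ 2 + d);
    (18 * f ^+ 2 - 12 * f * g + 2 * g ^+ 2 + d)
      * (- 18 * f ^+ 2 - 20 * f * g - 2 * g ^+ 2 + d)].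

(* The indeterminates of Q[f, g, d]. *)
Definition Xf : {mpoly rat[3]} := 'X_(inord 0).
Definition Xg : {mpoly rat[3]} := 'X_(inord 1).
Definition Xd : {mpoly rat[3]} := 'X_(inord 2).

(* Main.v *)
(** The power-sum and product identities are polynomial identities, true in any
    commutative ring. For the nontriviality, a ring morphism sends equal
    multisets to equal multisets, so it is enough that the two sextuples differ
    after specialising the indeterminates to (f, g, d) = (1, 2, 1). *)

Require Import Defs.
From HB Require Import structures.
From mathcomp Require Import all_boot all_order all_algebra.
From mathcomp Require Import mpoly ring.

Set Implicit Arguments.
Unset Strict Implicit.
Unset Printing Implicit Defensive.

Import GRing.Theory.
Local Open Scope ring_scope.

Section Identities.
Variables (R : comNzRingType) (f g d : R).

Lemma power_sums_xs_ys (r : nat) : (1 <= r <= 4)%N ->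
  \sum_(i < 6) tnth (xs f g d) i ^+ r = \sum_(i < 6) tnth (ys f g d) i ^+ r.
Proof.
(* Passing from indices to the tuple itself lets the sum unfold into six explicit terms. *)
rewrite -!(big_tuple _ _ _ xpredT (fun a : R => a ^+ r)) /= !big_cons !big_nil.
by case: r => [|[|[|[|[|r]]]]] // _; ring.
Qed.

Lemma prod_xs_ys :
  \prod_(i < 6) tnth (xs f g d) i = \prod_(i < 6) tnth (ys f g d) i.
Proof.
rewrite -!(big_tuple _ _ _ xpredT (fun a : R => a)) /= !big_cons !big_nil.
ring.
Qed.

End Identities.

Lemma map_xs (R S : comNzRingType) (phi : {rmorphism R -> S}) (f g d : R) :
  map phi (xs f g d) = xs (phi f) (phi g) (phi d).
Proof. by rewrite /=; do 6!(congr cons; first by ring). Qed.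

Lemma map_ys (R S : comNzRingType) (phi : {rmorphism R -> S}) (f g d : R) :
  map phi (ys f g d) = ys (phi f) (phi g) (phi d).
Proof. by rewrite /=; do 6!(congr cons; first by ring). Qed.

(** The images are named through equations so that numerals can stand for [phi f], [phi g],
    [phi d]. *)
Lemma not_perm_eq_xs_ys_morph (R S : comNzRingType) (phi : {rmorphism R -> S})
    (f g d : R) (f' g' d' : S) :
  phi f = f' -> phi g = g' -> phi d = d' ->
  ~~ perm_eq (xs f' g' d') (ys f' g' d') -> ~~ perm_eq (xs f g d) (ys f g d).
Proof.
move=> <- <- <-; rewrite -map_xs -map_ys; apply: contra; exact: perm_map.
Qed.

(** Over [int] the comparison is decided by evaluation: for instance -67 occurs only on the left. *)
Lemma not_perm_eq_xs_ys_int : ~~ perm_eq (xs 1 2 1 : seq int) (ys 1 2 1).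
Proof. by vm_compute. Qed.

Lemma not_perm_eq_xs_ys_rat : ~~ perm_eq (xs 1 2 1 : seq rat) (ys 1 2 1).
Proof.
apply: contra not_perm_eq_xs_ys_int => xy.
(* The embedding of [int] into [rat] is injective, so a permutation over [rat] descends to [int]. *)
apply: (perm_map_inj (intr_inj (R := rat))).
by rewrite map_xs map_ys.
Qed.

Lemma not_perm_eq_xs_ys_mpoly : ~~ perm_eq (xs Xf Xg Xd) (ys Xf Xg Xd).
Proof.
(* The default 0 is never reached, as [i < 3]. *)
pose v (i : 'I_3) : rat := nth 0 [:: 1; 2; 1] i.
have vf : meval v Xf = 1 by rewrite mevalXU /v inordK.
have vg : meval v Xg = 2 by rewrite mevalXU /v inordK.
have vd : meval v Xd = 1 by rewrite mevalXU /v inordK.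
exact: (not_perm_eq_xs_ys_morph (phi := meval v) vf vg vd not_perm_eq_xs_ys_rat).
Qed.

Theorem mainTheorem9 :
  (forall f g d : rat,
     (forall r : nat, (1 <= r <= 4)%N ->
        \sum_(i < 6) tnth (xs f g d) i ^+ r =
        \sum_(i < 6) tnth (ys f g d) i ^+ r) /\
     \prod_(i < 6) tnth (xs f g d) i = \prod_(i < 6) tnth (ys f g d) i) /\
  ~~ perm_eq (xs Xf Xg Xd) (ys Xf Xg Xd).
Proof.
split; last exact: not_perm_eq_xs_ys_mpoly.
by move=> f g d; split; [exact: power_sums_xs_ys | exact: prod_xs_ys].
Qed.
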